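(* Let $A:\mathbb{R}\to\mathbb{C}^{m\times m}$ be continuous with a full asymptotic expansion $A(\rho)\sim A_0+\rho A_1+\rho^2A_2+\cdots$ as $\rho\to0$, and let $n\in\{0,1,2,\ldots\}$. If $A(\rho)$ satisfies Assumption (A$_n$) (defined in the context), then there exist a small interval $I_n$ around $0$ and a uniformly bounded family of invertible matrices $M_n(\rho)$, $\rho\in I_n$, with uniformly bounded inverse, such that $$M_n^{-1}(\rho)A(\rho)M_n(\rho)$$ is diagonal modulo $\mathcal{O}(\rho^{n+1})$, i.e. equals a diagonal matrix depending on $\rho$ plus a remainder of size $\mathcal{O}(\rho^{n+1})$ as $\rho\to0$.
   Context: A matrix-valued function $F(\rho)$ has the full asymptotic expansion $F(\rho)\sim\sum_{k\ge0}\rho^kF_k$ as $\rho\to0$ if for every $N$ one has $F(\rho)=\sum_{k=0}^N\rho^kF_k+\mathcal{O}(\rho^{N+1})$. ''Diagonable'' means diagonalisable over $\mathbb{C}$; a diagonaliser of a matrix $X$ is an invertible $T$ with $T^{-1}XT$ diagonal. $[X,Y]=XY-YX$. For an equivalence relation $\sim_\Pi$ on $\{1,\dots,m\}$ (a partition $\Pi$), $\mathrm{b\text{-}diag}_\Pi X$ is the matrix with entries $X_{ij}$ if $i\sim_\Pi j$ and $0$ otherwise; a matrix $X$ is $\Pi$-block-diagonal if $X=\mathrm{b\text{-}diag}_\Pi X$. Multi-step diagonalisation scheme. Step 0. Set $\tilde\Lambda_0=A_0$. If $\tilde\Lambda_0$ is diagonable, choose a diagonaliser $M_0$ with $M_0^{-1}A_0M_0=\Lambda_0=\mathrm{diag}(\lambda^{[0]}_1,\dots,\lambda^{[0]}_m)$,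 equal eigenvalues being in consecutive positions. Put $i\sim_{\Pi_0}j$ iff $\lambda_i^{[0]}=\lambda_j^{[0]}$, and $\tilde A^{[0]}(\rho)=M_0^{-1}A(\rho)M_0$. Step $k+1$ ($k\ge0$). Suppose that $\tilde A^{[k]}(\rho)\sim\Lambda_0+\rho\Lambda_1+\cdots+\rho^k\Lambda_k+\rho^{k+1}\tilde A^{[k]}_{k+1}+\cdots$ has been constructed, with diagonal $\Lambda_{k'}=\mathrm{diag}(\lambda_1^{[k']},\dots,\lambda_m^{[k']})$ and with partitions given by $i\sim_{\Pi_\ell}j$ iff $\lambda_i^{[k']}=\lambda_j^{[k']}$ for all $k'\le \ell$ ($\ell\le k$). Let $A^{[k,0]}_{k+1}=\mathrm{b\text{-}diag}_{\Pi_0}\tilde A^{[k]}_{k+1}$ and let $K^{[k]}_0$ solve $[\Lambda_0,K^{[k]}_0]+\tilde A^{[k]}_{k+1}-A^{[k,0]}_{k+1}=0$. For $\ell=1,\dots,k$ let $A^{[k,\ell]}_{k+1}=\mathrm{b\text{-}diag}_{\Pi_\ell}A^{[k,\ell-1]}_{k+1}$ and let $K^{[k]}_\ell$ be a $\Pi_{\ell-1}$-block-diagonal solution of $[\Lambda_\ell,K^{[k]}_\ell]+A^{[k,\ell-1]}_{k+1}-A^{[k,\ell]}_{k+1}=0$. (For definiteness each $K^{[k]}_\ell$ is taken with zero $(i,j)$ entries whenever $i\sim_{\Pi_\ell}j$.) Set $\tilde\Lambda_{k+1}=A^{[k,k]}_{k+1}$, which is $\Pi_k$-block-diagonal. If $\tilde\Lambda_{k+1}$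 is diagonable, choose a $\Pi_k$-block-diagonal diagonaliser $\tilde M_{k+1}$, so that $\tilde M_{k+1}^{-1}\tilde\Lambda_{k+1}\tilde M_{k+1}=\Lambda_{k+1}$ is diagonal with equal entries within each $\Pi_k$-class in consecutive positions. Then, for small $\rho$, $\tilde A^{[k+1]}(\rho)=S(\rho)^{-1}\tilde A^{[k]}(\rho)S(\rho)$ with $S(\rho)=(I+\rho^{k+1}K^{[k]}_0)(I+\rho^{k}K^{[k]}_1)\cdots(I+\rho K^{[k]}_k)\tilde M_{k+1}$, and it has an expansion $\Lambda_0+\cdots+\rho^{k+1}\Lambda_{k+1}+\rho^{k+2}\tilde A^{[k+1]}_{k+2}+\cdots$, so that the scheme continues. The family $A(\rho)$ satisfies Assumption (A$_n$) if the matrices $\tilde\Lambda_k$, $k=0,1,\dots,n$, are all diagonable (with any fixed admissible choices in the scheme). *)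

(* Defs.v *)
From HB Require Import structures.
From mathcomp Require Import all_boot all_order all_algebra complex.
From mathcomp Require Import all_classical all_reals all_analysis.

Set Implicit Arguments.
Unset Strict Implicit.
Unset Printing Implicit Defensive.

Import Order.TTheory GRing.Theory Num.Theory.
Import numFieldNormedType.Exports.

Local Open Scope classical_set_scope.
Local Open Scope ring_scope.
Local Open Scope complex_scope.

(* MathComp-Analysis equips the regular module K^o of any numFieldType K with
   the topology of its norm, but not the concrete type R[i]; this copy also
   makes 'M[R[i]]_m a normed space, for the maximum norm of the entries. *)
HB.instance Definition _ (R : rcfType) :=
  NormedModule.copy R[i] (R[i] : numFieldType)^o.

Section Scheme.
Context {R : realType} {m : nat}.
Implicit Types (F : R -> 'M[R[i]]_m) (X Y : 'M[R[i]]_m) (P : rel 'I_m).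

(* The filter is the punctured one: the value F 0 plays no role. *)
Definition asymp_expansion F (c : nat -> 'M[R[i]]_m) : Prop :=
  forall N : nat,
    (fun rho : R => F rho - \sum_(k < N.+1) rho%:C ^+ k *: c k)
      =O_ (dnbhs (0 : R)) (fun rho : R => rho%:C ^+ N.+1).

(* The k-th coefficient of the full asymptotic expansion of F (such an
   expansion is unique), and 0 when F has none. *)
Definition asymp_coef F : nat -> 'M[R[i]]_m :=
  xget (fun=> 0) [set c | asymp_expansion F c].

Definition bracket X Y := X *m Y - Y *m X.

Definition bdiag P X : 'M[R[i]]_m :=
  \matrix_(i, j) if P i j then X i j else 0.

(* The choices made along the scheme: chM k is the diagonaliser of the k-th
   step (M_0 for k = 0, tilde M_k for k > 0), chlam k is the diagonal of
   Lambda_k, and chK k l is K^[k]_l. They are sequences for convenience only: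
   [admissible] below constrains just the finitely many used up to step n. *)
Record choices := Choices {
  chM : nat -> 'M[R[i]]_m;
  chlam : nat -> 'rV[R[i]]_m;
  chK : nat -> nat -> 'M[R[i]]_m }.

Implicit Types (s : choices) (k l : nat).

Definition Lambda s k : 'M[R[i]]_m := diag_mx (chlam s k).

Definition part s l : rel 'I_m :=
  fun i j => [forall k : 'I_l.+1, chlam s k 0 i == chlam s k 0 j].

(* The product is ordered: the factor of K^[k]_0 is leftmost. *)
Definition Smx s k (rho : R) : 'M[R[i]]_m :=
  (\prod_(l < k.+1) (1%:M + rho%:C ^+ (k.+1 - l) *: chK s k l))
    *m chM s k.+1.

Fixpoint Atilde A s k : R -> 'M[R[i]]_m :=
  match k with
  | 0 => fun rho => invmx (chM s 0) *m A rho *m chM s 0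
  | k'.+1 => fun rho => invmx (Smx s k' rho) *m Atilde A s k' rho *m Smx s k' rho
  end.

Fixpoint bdiags s X l : 'M[R[i]]_m :=
  match l with
  | 0 => bdiag (part s 0) X
  | l'.+1 => bdiag (part s l) (bdiags s X l')
  end.

(* A^[k,l]_{k+1} *)
Definition Astage A s k l := bdiags s (asymp_coef (Atilde A s k) k.+1) l.

Definition Ltilde A s k : 'M[R[i]]_m :=
  match k with
  | 0 => asymp_coef A 0
  | k'.+1 => Astage A s k' k'
  end.

Definition diagonaliser X T : Prop :=
  T \in unitmx /\ is_diag_mx (invmx T *m X *m T).

(* Within each P-class, equal entries of v occupy consecutive positions. *)
Definition grouped P (v : 'rV[R[i]]_m) : Prop :=
  forall i j l : 'I_m, (i <= j <= l)%N -> P i j -> P i l ->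
    v 0 i = v 0 l -> v 0 i = v 0 j.

Definition admissible_M0 A s : Prop :=
  [/\ diagonaliser (Ltilde A s 0) (chM s 0),
      invmx (chM s 0) *m Ltilde A s 0 *m chM s 0 = Lambda s 0
    & grouped (fun _ _ => true) (chlam s 0)].

Definition admissible_K A s k : Prop :=
  [/\ bracket (Lambda s 0) (chK s k 0)
        + asymp_coef (Atilde A s k) k.+1 - Astage A s k 0 = 0,
      forall l, (l < k)%N ->
        chK s k l.+1 = bdiag (part s l) (chK s k l.+1) /\
        bracket (Lambda s l.+1) (chK s k l.+1)
          + Astage A s k l - Astage A s k l.+1 = 0
    & forall l (i j : 'I_m), (l <= k)%N -> part s l i j -> chK s k l i j = 0].

Definition admissible_M A s k : Prop :=
  [/\ diagonaliser (Ltilde A s k.+1) (chM s k.+1),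
      chM s k.+1 = bdiag (part s k) (chM s k.+1),
      invmx (chM s k.+1) *m Ltilde A s k.+1 *m chM s k.+1 = Lambda s k.+1
    & grouped (part s k) (chlam s k.+1)].

Definition admissible A s (n : nat) : Prop :=
  (diagonalizable (Ltilde A s 0) -> admissible_M0 A s) /\
  forall k, (k < n)%N ->
    admissible_K A s k /\
    (diagonalizable (Ltilde A s k.+1) -> admissible_M A s k).

Definition assumption_A A (n : nat) : Prop :=
  exists s : choices, admissible A s n /\
    forall k, (k <= n)%N -> diagonalizable (Ltilde A s k).

End Scheme.

(* Main.v *)
Require Import Defs.
From HB Require Import structures.
From mathcomp Require Import all_boot all_order all_algebra complex.
From mathcomp Require Import all_classical all_reals all_analysis.
From mathcomp Require Import zify ring.

(* Conjugating a family by 1 + rho^p K with p >= 1 is solving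
   G = F + rho^p (F K - K G), so full expansions are preserved and their
   coefficients satisfy a recursion. When K commutes with the coefficients of
   order less than l, and p = k + 1 - l, the recursion leaves the orders up to k
   unchanged and adds [F_l, K] at order k + 1. Hence the k + 1 conjugations of a
   step turn the coefficient of order k + 1 into tilde Lambda_(k+1) without
   disturbing Lambda_0, ..., Lambda_k, and the block structure of tilde M_(k+1) makes it
   commute with the latter. All the conjugating families are bounded near 0 with
   bounded inverse, and so is their product; at rho = 0, where the expansions say
   nothing, it is replaced by M_0. *)

Set Implicit Arguments.
Unset Strict Implicit.
Unset Printing Implicit Defensive.

Import Order.TTheory GRing.Theory Num.Theory.
Import numFieldNormedType.Exports.

Local Open Scope classical_set_scope.
Local Open Scope ring_scope.
Local Open Scope complex_scope.

Section Estimates.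
Context {R : realType} {m : nat}.
Implicit Types (F G : R -> 'M[R[i]]_m) (X Y K : 'M[R[i]]_m) (N p : nat).
Implicit Types (c d : nat -> 'M[R[i]]_m).

(** * Neighbourhoods of 0 and the maximum norm of matrices *)

Lemma near0_norm_lt (e : R[i]) : 0 < e -> \forall rho \near (0 : R), `|rho%:C| < e.
Proof.
move=> e0; have eE : e = (complex.Re e)%:C by rewrite RRe_real// gtr0_real.
have e0' : 0 < complex.Re e by move: e0; rewrite {1}eE ltcR.
near=> rho; rewrite eE normc_def/= expr0n/= addr0 sqrtr_sqr ltcR.
by near: rho; exact: (@nbhs0_lt _ R^o).
Unshelve. all: by end_near. Qed.

(** Expansions live on the punctured filter, while the theorem asks for a bound on a full
    neighbourhood; the point 0 is settled separately. *)
Lemma near_dnbhs (P : R -> Prop) : (\forall rho \near (0 : R)^', P rho) -> P 0 ->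
  \forall rho \near (0 : R), P rho.
Proof.
move=> P' P0; apply: (@filterS _ (nbhs (0 : R)) _ (fun y => y != 0 -> P y)) P' => rho.
by have [->|_ /(_ isT)] := eqVneq rho 0.
Qed.

Lemma norm_entry X i j : `|X i j| <= `|X|.
Proof.
by rewrite -[leRHS]/(mx_norm X) mx_normE -[leLHS]nngE num_le; exact: (le_bigmax _ _ (i, j)).
Qed.

(** The maximum norm is not submultiplicative: each entry of the product is a sum of [m] terms,
    whence the factor [m]. *)
Lemma norm_mulmx X Y : `|X *m Y| <= m%:R * `|X| * `|Y|.
Proof.
have [XY0|XY0] := eqVneq (mx_norm (X *m Y)) 0.
  by rewrite -[leLHS]/(mx_norm (X *m Y)) XY0 !mulr_ge0.
rewrite -[leLHS]/(mx_norm (X *m Y)); have [[i j] ->] := mx_norm_neq0 XY0; rewrite /= mxE.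
apply: le_trans (ler_norm_sum _ _ _) _.
rewrite -mulrA mulr_natl (_ : _ *+ m = \sum_(k < m) `|X| * `|Y|); last first.
  by rewrite sumr_const card_ord.
by apply: ler_sum => k _; rewrite normrM ler_pM// norm_entry.
Qed.

(** * Families of size O(rho^N) *)

(** Norms take values in [R[i]], so the constant does too, and [0 <= C] makes it real. The weak
    inequality lets norms themselves serve as constants. *)
Definition small N F := exists2 C : R[i], 0 <= C &
  \forall rho \near (0 : R)^', `|F rho| <= C * `|rho%:C| ^+ N.

Lemma bigO_small N F :
  F =O_ (dnbhs (0 : R)) (fun rho : R => rho%:C ^+ N) <-> small N F.
Proof.
split => [/eqO_exP[C C0 FC]|[C C0 FC]].
  by exists C; [exact: ltW|apply: filterS FC => rho; rewrite normrX].
apply/eqO_exP; exists (C + 1); first by rewrite ltr_wpDl.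
apply: filterS FC => rho /le_trans; apply.
by rewrite normrX ler_wpM2r ?exprn_ge0// lerDl.
Qed.

Lemma small_eq N F G : (\forall rho \near (0 : R)^', F rho = G rho) ->
  small N F -> small N G.
Proof.
by move=> FG [C C0 FC]; exists C => //; apply: filterS2 FG FC => rho ->.
Qed.

Lemma smallD N F G : small N F -> small N G -> small N (fun rho => F rho + G rho).
Proof.
move=> [C C0 FC] [D D0 GD]; exists (C + D); first exact: addr_ge0.
apply: filterS2 FC GD => rho FC GD.
by rewrite mulrDl (le_trans (ler_normD _ _))// lerD.
Qed.

Lemma smallN N F : small N F -> small N (fun rho => - F rho).
Proof. by move=> [C C0 FC]; exists C => //; apply: filterS FC => rho; rewrite normrN. Qed.

Lemma small_mulmx N p F G : small N F -> small p G ->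
  small (N + p) (fun rho => F rho *m G rho).
Proof.
move=> [C C0 FC] [D D0 GD]; exists (m%:R * C * D); first by rewrite !mulr_ge0.
apply: filterS2 FC GD => rho FC GD; apply: le_trans (norm_mulmx _ _) _.
rewrite exprD -!mulrA ler_wpM2l// [leRHS](_ : _ = (C * `|rho%:C| ^+ N) * (D * `|rho%:C| ^+ p)).
  by rewrite ler_pM.
by rewrite -!mulrA; congr (_ * _); rewrite mulrCA.
Qed.

Lemma small_const X : small 0 (fun=> X).
Proof. by exists `|X| => //; near=> rho; rewrite expr0 mulr1. Unshelve. all: by end_near. Qed.

Lemma small_pow N p F : small N F -> small (N + p) (fun rho => rho%:C ^+ p *: F rho).
Proof.
move=> [C C0 FC]; exists C => //; apply: filterS FC => rho FC.
by rewrite normrZ normrX addnC exprD mulrCA ler_wpM2l// exprn_ge0.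
Qed.

Lemma small_weaken N p F : (p <= N)%N -> small N F -> small p F.
Proof.
move=> /subnK <- [C C0 FC]; exists C => //.
have /nbhs_dnbhs rho1 := near0_norm_lt (@ltr01 R[i]).
apply: filterS2 rho1 FC => rho rho1 /le_trans; apply.
rewrite ler_wpM2l// exprD ler_piMl// ?exprn_ge0// exprn_ile1//; exact: ltW.
Qed.

Lemma small1_const X : small 1 (fun=> X) -> X = 0.
Proof.
move=> [C C0 XC]; apply/eqP/negPn/negP => X0.
(* Below this radius [C * |rho|] is smaller than [|X|]; the [+ 1] covers [C = 0]. *)
have e0 : 0 < `|X| / (C + 1) by rewrite divr_gt0 ?normr_gt0// ltr_wpDl.
have /nbhs_dnbhs Xlt := near0_norm_lt e0.
have /filter_ex[rho] : \forall rho \near (0 : R)^', `|X| < `|X|; last by rewrite ltxx.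
apply: filterS2 XC Xlt => rho XC; rewrite ltr_pdivlMr ?ltr_wpDl//; apply: le_lt_trans.
by rewrite (le_trans XC)// expr1 mulrC ler_wpM2l// lerDl.
Qed.

(** * Truncated expansions *)

(** Only [N] terms are kept, with an error of order [N]: the index is one more than in
    [asymp_expansion], and [N = 0] says that [F] is bounded, which starts inductions. *)
Definition expands N F c := small N (fun rho => F rho - \sum_(k < N) rho%:C ^+ k *: c k).

Lemma expands_weaken1 N F c : expands N.+1 F c -> expands N F c.
Proof.
move=> FN; have /smallD := @small_weaken _ N _ (leqnSn N) FN.
move=> /(_ _ (small_pow N (small_const (c N)))); apply: small_eq.
by near=> rho; rewrite big_ord_recr/= opprD addrA addrNK.
Unshelve. all: by end_near. Qed.

Lemma expands_weaken N p F c : (p <= N)%N -> expands N F c -> expands p F c.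
Proof.
move=> /subnK <-; elim: (N - p)%N => // q IH; rewrite addSn => /expands_weaken1; exact: IH.
Qed.

Lemma asymp_expansionP F c : asymp_expansion F c <-> forall N, expands N F c.
Proof.
split => [Fc N|Fc N]; last exact/bigO_small/(Fc N.+1).
by apply: expands_weaken1; apply/bigO_small/(Fc N).
Qed.

Lemma expands_eq N F G c : (\forall rho \near (0 : R)^', F rho = G rho) ->
  expands N F c -> expands N G c.
Proof. by move=> FG; apply: small_eq; apply: filterS FG => rho ->. Qed.

Lemma eq_expands N F c d : c =1 d -> expands N F c -> expands N F d.
Proof.
move=> cd; apply: small_eq; near=> rho.
by congr (_ - _); apply: eq_bigr => k _; rewrite cd.
Unshelve. all: by end_near. Qed.

Lemma expandsD N F G c d : expands N F c -> expands N G d ->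
  expands N (fun rho => F rho + G rho) (fun k => c k + d k).
Proof.
move=> Fc Gd; have := smallD Fc Gd; apply: small_eq; near=> rho.
under [in RHS]eq_bigr do rewrite scalerDr.
by rewrite big_split/= opprD addrACA.
Unshelve. all: by end_near. Qed.

Lemma expandsN N F c : expands N F c -> expands N (fun rho => - F rho) (fun k => - c k).
Proof.
move=> /smallN; apply: small_eq; near=> rho.
by under [in RHS]eq_bigr do rewrite scalerN; rewrite sumrN opprD.
Unshelve. all: by end_near. Qed.

Lemma expands_mull N F c K : expands N F c ->
  expands N (fun rho => K *m F rho) (fun k => K *m c k).
Proof.
move=> /(small_mulmx (small_const K)); apply: small_eq; near=> rho.
by rewrite mulmxBr mulmx_sumr; under [in RHS]eq_bigr do rewrite scalemxAr.
Unshelve. all: by end_near. Qed.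

Lemma expands_mulr N F c K : expands N F c ->
  expands N (fun rho => F rho *m K) (fun k => c k *m K).
Proof.
move=> Fc; have := small_mulmx Fc (small_const K); rewrite addn0; apply: small_eq; near=> rho.
by rewrite mulmxBl mulmx_suml; under [in RHS]eq_bigr do rewrite scalemxAl.
Unshelve. all: by end_near. Qed.

Lemma expands_pow N p F c : expands N F c ->
  expands (p + N) (fun rho => rho%:C ^+ p *: F rho)
    (fun k => if (p <= k)%N then c (k - p)%N else 0).
Proof.
move=> /(small_pow p); rewrite addnC; apply: small_eq; near=> rho.
rewrite scalerBr big_split_ord/= [X in _ - (X + _)]big1 => [|k _]; last first.
  by rewrite leqNgt ltn_ord scaler0.
rewrite add0r scaler_sumr; congr (_ - _); apply: eq_bigr => k _.
by rewrite leq_addr addKn scalerA exprD.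
Unshelve. all: by end_near. Qed.

(** Once the coefficients below [N] agree, the two truncations differ by rho^N (c_N - d_N) up to
    O(rho^(N+1)); division by rho^N leaves a constant of size O(rho). *)
Lemma expands_unique F c d : (forall N, expands N F c) -> (forall N, expands N F d) ->
  c =1 d.
Proof.
move=> Fc Fd; elim/ltn_ind => N IH; apply/eqP; rewrite -subr_eq0; apply/eqP.
apply: small1_const; have [C C0 FC] := smallD (Fd N.+1) (smallN (Fc N.+1)).
exists C => //; have := @nbhs_dnbhs_neq _ (0 : R).
apply: filterS2 FC => rho FC rho0.
have rho0' : 0 < `|rho%:C| by rewrite normr_gt0 fmorph_eq0.
rewrite -(@ler_pM2l _ (`|rho%:C| ^+ N)) ?exprn_gt0// -normrX -normrZ.
rewrite expr1 mulrCA -normrM -exprSr normrX.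
move: FC; rewrite opprB addrC addrA addrNK !big_ord_recr/=.
rewrite (eq_bigr (fun k : 'I_N => rho%:C ^+ k *: d k)); last first.
  by move=> k _; rewrite IH.
by rewrite opprD addrACA subrr add0r -scalerBr.
Qed.

(** A nearby [rho != 0] links the two sides: [F rho] is within [e / 2] of [F 0] by continuity and of
    [c 0] by the expansion. *)
Lemma continuous_coef0 F c : {for 0, continuous F} -> expands 1 F c -> F 0 = c 0%N.
Proof.
move=> F0 F1.
have [B B0 FB] := F1.
apply/eqP; rewrite -subr_eq0 -normr_le0; apply/ler_addgt0Pl => e e0.
have e2 : 0 < e / 2 by rewrite divr_gt0.
have eB : 0 < e / 2 / (B + 1) by rewrite divr_gt0// ltr_wpDl.
have /nbhs_dnbhs Flim : \forall rho \near (0 : R), `|F 0 - F rho| <= e / 2.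
  by have /cvgrPdist_le := F0; apply.
have /nbhs_dnbhs rhoB := near0_norm_lt eB.
have [rho [le1 le2 rho_lt]] : exists rho : R,
    [/\ `|F 0 - F rho| <= e / 2, `|F rho - c 0%N| <= B * `|rho%:C| & `|rho%:C| < e / 2 / (B + 1)].
  apply: (@filter_ex _ (0 : R)^'); apply: filterS3 Flim FB rhoB => rho.
  by rewrite big_ord1 expr0 scale1r expr1.
rewrite addr0 (splitr e) -(subrKA (F rho)) (le_trans (ler_normD _ _))// lerD//.
rewrite (le_trans le2)//; move: rho_lt; rewrite ltr_pdivlMr ?ltr_wpDl// => /ltW.
by apply: le_trans; rewrite mulrC ler_wpM2l// lerDl.
Qed.

Lemma asymp_coefE F c : (forall N, expands N F c) -> asymp_coef F = c.
Proof.
move=> Fc; apply: xget_unique; first exact/asymp_expansionP.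
move=> d /asymp_expansionP Fd; apply/funext; exact: expands_unique Fd Fc.
Qed.

(** * Bounded families with bounded inverse, and conjugation by them *)

(** The neighbourhood is not punctured, since the final family must be invertible on a whole
    interval. *)
Definition tame F := exists C : R[i], \forall rho \near (0 : R),
  [/\ F rho \in unitmx, `|F rho| <= C & `|invmx (F rho)| <= C].

Lemma invmxM X Y : X \in unitmx -> Y \in unitmx -> invmx (X *m Y) = invmx Y *m invmx X.
Proof.
move=> uX uY; have uXY : X *m Y \in unitmx by rewrite unitmx_mul uX.
apply: (can_inj (mulmxK uXY)); rewrite mulVmx//.
by rewrite mulmxA -(mulmxA (invmx Y)) mulVmx// mulmx1 mulVmx.
Qed.

Lemma tame_const X : X \in unitmx -> tame (fun=> X).
Proof.
move=> uX; exists (`|X| + `|invmx X|); near=> rho.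
by split; rewrite ?lerDl ?lerDr.
Unshelve. all: by end_near. Qed.

Lemma tame_mulmx F G : tame F -> tame G -> tame (fun rho => F rho *m G rho).
Proof.
move=> [C FC] [D GD]; exists (m%:R * (C * D)); apply: filterS2 FC GD.
move=> rho [uF FC iFC] [uG GD iGD]; split; first by rewrite unitmx_mul uF.
  by rewrite (le_trans (norm_mulmx _ _))// -mulrA ler_wpM2l// ler_pM.
rewrite invmxM// (le_trans (norm_mulmx _ _))// -mulrA ler_wpM2l//.
by rewrite mulrC ler_pM.
Qed.

(* Multiplication by 1 + rho^p K changes norms by a factor of at least 1/2. *)
Lemma tame_unipotent p K : (0 < p)%N -> tame (fun rho => 1%:M + rho%:C ^+ p *: K).
Proof.
move=> p0; exists (`|1%:M : 'M[R[i]]_m| *+ 2 + `|K|).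
(* This radius makes [|rho| * (m * |K|)] at most 1/2. *)
have e0 : 0 < (m%:R * `|K| + 1)^-1 / 2 :> R[i] by rewrite divr_gt0 ?invr_gt0 ?ltr_wpDl ?mulr_ge0.
near=> rho.
have rho1 : `|rho%:C| < 1 by near: rho; exact: near0_norm_lt.
have rhop : `|rho%:C ^+ p| <= `|rho%:C|.
  by rewrite normrX -(prednK p0) exprS ler_piMr// exprn_ile1// ltW.
have half X : `|X| <= `|X *m (1%:M + rho%:C ^+ p *: K)| *+ 2.
  have XK : `|X *m (rho%:C ^+ p *: K)| <= `|X| / 2.
    rewrite -scalemxAr normrZ.
    have le1 := ler_pM (normr_ge0 _) (normr_ge0 _) rhop (norm_mulmx X K).
    apply: le_trans le1 _.
    have /ltW rhoe : `|rho%:C| < (m%:R * `|K| + 1)^-1 / 2 by near: rho; exact: near0_norm_lt.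
    rewrite [leLHS](_ : _ = `|X| * (`|rho%:C| * (m%:R * `|K|))); last by ring.
    rewrite ler_wpM2l//; have mK0 : 0 <= m%:R * `|K| :> R[i] by rewrite mulr_ge0.
    apply: le_trans (ler_wpM2r mK0 rhoe) _.
    rewrite mulrAC ler_piMl ?invr_ge0// mulrC ler_pdivrMr ?ltr_wpDl//.
    by rewrite mul1r lerDl.
  (* Write X as X T - X (rho^p K) with T = 1 + rho^p K, and absorb the last term, of norm at most
     [|X| / 2]. *)
  have := ler_normB (X *m (1%:M + rho%:C ^+ p *: K)) (X *m (rho%:C ^+ p *: K)).
  rewrite -mulmxBr addrK mulmx1 => /le_trans/(_ (lerD (lexx _) XK)).
  rewrite -lerBlDr -[X in X - _]mulr1 -mulrBr.
  rewrite (_ : 1 - 2^-1 = 2^-1); last by rewrite {1}(splitr 1) mul1r addrK.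
  by rewrite ler_pdivrMr// mulr_natr.
have uT : 1%:M + rho%:C ^+ p *: K \in unitmx.
  (* The kernel matrix is annihilated by T, so [half] bounds its norm by 0. *)
  rewrite -row_free_unit -kermx_eq0 -normr_le0; apply: le_trans (half _) _.
  by rewrite mulmx_ker normr0 mul0rn.
split => //.
  rewrite (le_trans (ler_normD _ _))// lerD//; first by rewrite mulr2n lerDl.
  by rewrite normrZ ler_piMl// (le_trans rhop)// ltW.
(* Here [half] is applied to the inverse of T, whose product with T is 1. *)
by rewrite (le_trans (half _))// mulVmx// lerDl.
Unshelve. all: by end_near. Qed.

Lemma tame_small F : tame F -> small 0 F /\ small 0 (fun rho => invmx (F rho)).
Proof.
move=> [C /nbhs_dnbhs FC].
have C0 : 0 <= C by have /filter_ex[rho [_ /(le_trans (normr_ge0 _))]] := FC.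
by split; exists C => //; apply: filterS FC => rho []; rewrite expr0 mulr1.
Qed.

Lemma tame_unit F : tame F -> \forall rho \near (0 : R)^', F rho \in unitmx.
Proof. by move=> [C /nbhs_dnbhs FC]; apply: filterS FC => rho []. Qed.

(* The conjugate G satisfies G = F + rho^p (F K - K G), so that its expansion to
   order N determines the one to order N + p. *)
Lemma expands_conj p K F c d : (0 < p)%N -> (forall N, expands N F c) ->
  (forall k, d k = c k + if (p <= k)%N
                         then c (k - p)%N *m K - K *m d (k - p)%N else 0) ->
  forall N, expands N (fun rho => invmx (1%:M + rho%:C ^+ p *: K) *m F rho
                                    *m (1%:M + rho%:C ^+ p *: K)) d.
Proof.
move=> p0 Fc dE; set G := fun rho => _; have tT := tame_unipotent K p0.
elim=> [|N IH].
  have [sT sTi] := tame_small tT.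
  have sF : small 0 F by apply: small_eq (Fc 0%N); near=> rho; rewrite big_ord0 subr0.
  have := small_mulmx (small_mulmx sTi sF) sT; apply: small_eq.
  by near=> rho; rewrite big_ord0 subr0.
(* As p is positive, order N of G on the right of G = F + rho^p (F K - K G) suffices for order N + 1
   on the left. *)
have NpN : (N.+1 <= p + N)%N by rewrite -addn1 addnC leq_add2r.
have := expandsD (expands_mulr K (Fc N)) (expandsN (expands_mull K IH)).
move=> /(expands_pow p) /(expands_weaken NpN).
move=> /(expandsD (Fc N.+1)) /(eq_expands (fun k => esym (dE k))).
apply: expands_eq; apply: filterS (tame_unit tT) => rho uT.
rewrite scalerBr addrA; apply/eqP; rewrite subr_eq; apply/eqP.
have -> : G rho + rho%:C ^+ p *: (K *m G rho) = (1%:M + rho%:C ^+ p *: K) *m G rho.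
  by rewrite mulmxDl mul1mx scalemxAl.
by rewrite /G !mulmxA mulmxV// mul1mx mulmxDr mulmx1 scalemxAr.
Unshelve. all: by end_near. Qed.

(** Since [d k] depends only on [d (k - p)] with p positive, the iterates of [step] are stationary
    at index k after k + 1 rounds. *)
Lemma conj_coef_ex p K c : (0 < p)%N -> exists d, forall k,
  d k = c k + if (p <= k)%N then c (k - p)%N *m K - K *m d (k - p)%N else 0.
Proof.
move=> p0; pose step (d : nat -> 'M[R[i]]_m) k :=
  c k + if (p <= k)%N then c (k - p)%N *m K - K *m d (k - p)%N else 0.
have stepS n k : (k < n)%N -> iter n.+1 step (fun=> 0) k = iter n step (fun=> 0) k.
  elim: n k => // n IH k kn; rewrite iterS [in RHS]iterS /step.
  case: leqP => // pk; rewrite -/step IH//; lia.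
have stepE n k : (k < n)%N -> iter n step (fun=> 0) k = iter k.+1 step (fun=> 0) k.
  by move=> /subnK <-; elim: (n - k.+1)%N => // q IH; rewrite addSn stepS ?leq_addl.
exists (fun k => iter k.+1 step (fun=> 0) k) => k.
rewrite -[LHS]/(step (iter k step (fun=> 0)) k) {1}/step; case: leqP => // pk; rewrite stepE//; lia.
Qed.

End Estimates.

(** * Coefficients along the diagonalisation scheme *)

Section Scheme.
Context {R : realType} {m : nat}.
Implicit Types (A : R -> 'M[R[i]]_m) (X K : 'M[R[i]]_m) (s : @choices R m).
Implicit Types (c d : nat -> 'M[R[i]]_m).

Lemma bdiag_diag_comm (P : rel _) (v : 'rV[R[i]]_m) X :
  (forall i j, P i j -> v 0 i = v 0 j) -> X = bdiag P X ->
  diag_mx v *m X = X *m diag_mx v.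
Proof.
move=> Pv ->; rewrite mul_diag_mx mul_mx_diag; apply/matrixP => i j; rewrite !mxE.
by case: ifP => [/Pv ->|_]; rewrite ?mul0r ?mulr0// mulrC.
Qed.

Lemma Lambda_comm s l k X : (k <= l)%N -> X = bdiag (part s l) X ->
  Lambda s k *m X = X *m Lambda s k.
Proof.
rewrite -ltnS => kl; apply: bdiag_diag_comm => i j /forallP/(_ (Ordinal kl)).
by move/eqP.
Qed.

(** For j <= k the recursion involves only the index j - p < l, where K commutes with the
    coefficient; order k + 1 = p + l is the first to see [c l]. *)
Lemma conj_coef_low p l k K c d :
  (forall j, d j = c j + if (p <= j)%N
                         then c (j - p)%N *m K - K *m d (j - p)%N else 0) ->
  (0 < p)%N -> (p + l = k.+1)%N -> (forall j, (j < l)%N -> c j *m K = K *m c j) ->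
  (forall j, (j <= k)%N -> d j = c j) /\ d k.+1 = c k.+1 + bracket (c l) K.
Proof.
move=> dE p0 plk cK; have low j : (j <= k)%N -> d j = c j.
  elim/ltn_ind: j => j IH jk; rewrite dE; case: leqP => [pj|_]; last by rewrite addr0.
  by rewrite IH; [rewrite cK ?subrr ?addr0//; lia|lia|lia].
split=> //; rewrite dE -plk leq_addr addKn low//; lia.
Qed.

(** Induction on the number l of factors already used: after l of them, the coefficient of order k +
    1 is A^[k,l-1]. *)
Lemma stage_expansion A s k c : admissible_K A s k ->
  (forall N, expands N (Atilde A s k) c) ->
  (forall j, (j <= k)%N -> c j = Lambda s j) ->
  forall l, (l <= k.+1)%N ->
  let P rho := \prod_(i < l) (1%:M + rho%:C ^+ (k.+1 - i) *: chK s k i) in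
  tame P /\ exists d,
    [/\ forall N, expands N (fun rho => invmx (P rho) *m Atilde A s k rho *m P rho) d,
        forall j, (j <= k)%N -> d j = c j
      & d k.+1 = if l is l'.+1 then Astage A s k l' else c k.+1].
Proof.
move=> [K0 Kl _] Fc cL; elim=> [_ /=|l IH lk /=].
  split.
    have [C HC] := tame_const (unitmx1 R[i] m).
    by exists C; apply: filterS HC => rho; rewrite big_ord0.
  exists c; split => // N; apply: expands_eq (Fc N); near=> rho.
  by rewrite big_ord0 invmx1 mul1mx mulmx1.
have [tP [d [Gd dc dk]]] := IH (ltnW lk).
pose T (rho : R) := 1%:M + rho%:C ^+ (k.+1 - l) *: chK s k l.
have p0 : (0 < k.+1 - l)%N by rewrite subn_gt0.
have tT : tame T by exact: tame_unipotent.
have PE rho : \prod_(i < l.+1) (1%:M + rho%:C ^+ (k.+1 - i) *: chK s k i)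
    = (\prod_(i < l) (1%:M + rho%:C ^+ (k.+1 - i) *: chK s k i)) *m T rho.
  by rewrite big_ord_recr/= mulmxE.
have [d' d'E] := conj_coef_ex (chK s k l) d p0.
have [|low d'k] := conj_coef_low d'E p0 (subnK (ltnW lk)).
  move=> j jl; rewrite dc; last by lia.
  rewrite cL; last by lia.
  (* For l = 0 no index j is below l; otherwise the block structure of K makes it commute with the
     earlier Lambda_j. *)
  case: l {IH tP Gd dk T p0 tT PE d'E} lk jl => // l lk jl.
  by apply: (@Lambda_comm s l) => //; have [] := Kl l lk.
split; first by under eq_fun do rewrite PE; exact: tame_mulmx.
exists d'; split.
- move=> N; apply: expands_eq (expands_conj p0 Gd d'E N).
  apply: filterS2 (tame_unit tP) (tame_unit tT) => rho uP uT.
  by rewrite PE invmxM// !mulmxA.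
- by move=> j jk; rewrite low// dc.
- rewrite d'k dk dc// (cL l)//.
  (* The equation defining K says that adding [Lambda_l, K] turns the old coefficient into A^[k,l].
     For l = 0 the old one is [asymp_coef], equal to [c k.+1] by uniqueness. *)
  case: l {IH tP Gd dk T p0 tT PE d'E low d'k} lk => [_|l lk].
    by move: K0; rewrite (asymp_coefE Fc) => /eqP; rewrite subr_eq0 addrC => /eqP.
  by have [_ /eqP] := Kl l lk; rewrite subr_eq0 addrC => /eqP.
Unshelve. all: by end_near. Qed.

Fixpoint transform s k : R -> 'M[R[i]]_m :=
  match k with
  | 0 => fun=> chM s 0
  | k'.+1 => fun rho => transform s k' rho *m Smx s k' rho
  end.

Lemma scheme_expansion A (A_ : nat -> 'M[R[i]]_m) s n : asymp_expansion A A_ ->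
  admissible A s n -> (forall k, (k <= n)%N -> diagonalizable (Ltilde A s k)) ->
  forall k, (k <= n)%N ->
  [/\ tame (transform s k),
      \forall rho \near (0 : R)^', Atilde A s k rho =
        invmx (transform s k rho) *m A rho *m transform s k rho
    & exists2 c, forall N, expands N (Atilde A s k) c &
        forall j, (j <= k)%N -> c j = Lambda s j].
Proof.
move=> /asymp_expansionP AA [adm0 adm] diagL; elim=> [_|k IH kn].
  have [[uM _] ML _] := adm0 (diagL 0%N (leq0n n)).
  split; [exact: tame_const|by near=> rho|].
  exists (fun j => invmx (chM s 0) *m A_ j *m chM s 0).
    by move=> N; exact/expands_mulr/expands_mull.
  by move=> j; rewrite leqn0 => /eqP ->; rewrite -ML/= (asymp_coefE AA).
have [tQ AE [c Fc cL]] := IH (ltnW kn).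
have [admK admM] := adm k kn.
have [[uM _] Mb ML _] := admM (diagL _ kn).
have [tP [d [Gd dc dk]]] := stage_expansion admK Fc cL (leqnn k.+1).
have tS : tame (Smx s k) by apply: tame_mulmx (tame_const uM).
split; first exact: tame_mulmx.
  apply: filterS3 AE (tame_unit tS) (tame_unit tQ) => rho AE uS uQ.
  by rewrite /= AE invmxM// !mulmxA.
exists (fun j => invmx (chM s k.+1) *m d j *m chM s k.+1).
  move=> N; apply: expands_eq (expands_mulr _ (expands_mull _ (Gd N))).
  apply: filterS (tame_unit tP) => rho uP.
  by rewrite /= /Smx invmxM// !mulmxA.
(* At order k + 1 all stages have produced [Astage A s k k], which is [Ltilde A s k.+1] by
   definition. *)
move=> j; rewrite leq_eqVlt => /predU1P[->|jk]; first by rewrite dk -ML.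
rewrite dc// cL// -mulmxA (Lambda_comm _ Mb)// mulmxA mulVmx// mul1mx//.
Unshelve. all: by end_near. Qed.

End Scheme.

Theorem proposition2p4 (R : realType) (m : nat) (A : R -> 'M[R[i]]_m)
    (A_ : nat -> 'M[R[i]]_m) (n : nat)
    (A_cont : continuous A)
    (A_exp : asymp_expansion A A_)
    (A_n : assumption_A A n) :
  exists (e : R) (M : R -> 'M[R[i]]_m) (D : R -> 'rV[R[i]]_m),
    [/\ 0 < e,
        forall rho : R, rho \in `]- e, e[ -> M rho \in unitmx,
        [bounded M rho | rho in `]- e, e[],
        [bounded invmx (M rho) | rho in `]- e, e[]
      & (fun rho : R => invmx (M rho) *m A rho *m M rho - diag_mx (D rho))
          =O_ (nbhs (0 : R)) (fun rho : R => rho%:C ^+ n.+1)].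
Proof.
have [s [adm diagL]] := A_n.
have [[uM _] ML _] := adm.1 (diagL 0%N (leq0n n)).
have [[C tM] AE [c Fc cL]] := scheme_expansion A_exp adm diagL (leqnn n).
(* At rho = 0 the bound rho^(n+1) vanishes, so the remainder must be exactly 0; this holds because
   M_0 diagonalises A_0 = A(0). *)
have A0 : A 0 = asymp_coef A 0.
  have /asymp_expansionP AA := A_exp; rewrite (asymp_coefE AA).
  exact: continuous_coef0 (A_cont 0) (AA 1%N).
pose M rho := if rho == 0 then chM s 0 else transform s n rho.
pose D (rho : R) := \sum_(k < n.+1) rho%:C ^+ k *: chlam s k.
have {tM} /nbhs_ballP[e /= e0 eM] : \forall rho \near (0 : R),
    [/\ M rho \in unitmx, `|M rho| <= C + `|chM s 0| & `|invmx (M rho)| <= C + `|invmx (chM s 0)|].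
  apply: filterS tM => rho [uT TC iTC]; rewrite /M; case: eqP => _; split => //.
  - by rewrite lerDr (le_trans _ TC).
  - by rewrite lerDr (le_trans _ TC).
  - by rewrite (le_trans TC)// lerDl.
  - by rewrite (le_trans iTC)// lerDl.
have {}eM rho : rho \in `]- e, e[ ->
    [/\ M rho \in unitmx, `|M rho| <= C + `|chM s 0| & `|invmx (M rho)| <= C + `|invmx (chM s 0)|].
  by move=> rhoe; apply: eM; rewrite -ball_normE/= sub0r normrN ltr_norml; rewrite in_itv in rhoe.
(* The bounds at 0 show that both constants are nonnegative, hence real, as boundedness demands. *)
have [|_ MC iMC] := eM 0; first by rewrite in_itv/= oppr_lt0 e0.
exists e, M, D; split => //.
- by move=> rho /eM[].
- exists (C + `|chM s 0|); split=> [|x /ltW Cx rho /eM[_ /le_trans le_C _]]; last exact: le_C.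
  by rewrite ger0_real// (le_trans _ MC).
- exists (C + `|invmx (chM s 0)|); split=> [|x /ltW Cx rho /eM[_ _ /le_trans le_C]]; last exact: le_C.
  by rewrite ger0_real// (le_trans _ iMC).
have diagD rho : diag_mx (D rho) = \sum_(k < n.+1) rho%:C ^+ k *: c k.
  rewrite /D linear_sum; apply: eq_bigr => k _.
  by rewrite cL -1?ltnS// /= linearZ.
have [B B0 FB] := Fc n.+1.
apply/eqO_exP; exists (B + 1); first by rewrite ltr_wpDl.
apply: near_dnbhs.
  have := @nbhs_dnbhs_neq _ (0 : R).
  apply: filterS3 AE FB => rho AE FB rho0.
  rewrite diagD /M (negbTE rho0) -AE (le_trans FB)// normrX.
  by rewrite ler_wpM2r ?exprn_ge0// lerDl.
rewrite diagD /M eqxx A0 ML big_ord_recl expr0 scale1r cL// big1 => [|k _].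
  by rewrite addr0 subrr normr0 mulr_ge0// addr_ge0.
by rewrite expr0n scale0r.
Qed.
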